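(* Let $d,r,p\ge 1$ be integers, $\mathcal{P}=\{1,\dots,p\}$, $\bm{A}\in\mathbb{R}^{r\times d}$, and for each $i\in\mathcal{P}$ let $\bm{X}_i\in\mathbb{R}^{n_i\times d}$, $\bm{O}_i\in\mathcal{O}(d)$, $\Psi_i\in\mathbb{R}^d$, and $$\bm{Y}_i=\bm{X}_i\bm{O}_i+\mathbf{1}_{n_i}\Psi_i^\top,\qquad \bm{B}_i=\bm{A}\bm{O}_i+\mathbf{1}_r\Psi_i^\top .$$ Let $\bm{a}=\frac1r\bm{A}^\top\mathbf{1}_r$ and $\overline{\bm{A}}=\bm{A}-\mathbf{1}_r\bm{a}^\top$, and assume that $\overline{\bm{A}}$ has full column rank. Let $c\in\mathcal{P}$ be the colluding participant, so that the attacker knows $\bm{A}$ and all pairs $(\bm{Y}_i,\bm{B}_i)$, $i\in\mathcal{P}$. Then the known-anchor attack, which from $\bm{A}$ and $\{(\bm{Y}_i,\bm{B}_i)\}_{i\in\mathcal{P}}$ computes for each $i\in\mathcal{P}\setminus\{c\}$ $$\bm{b}_i=\tfrac1r\bm{B}_i^\top\mathbf{1}_r,\quad \overline{\bm{B}}_i=\bm{B}_i-\mathbf{1}_r\bm{b}_i^\top,\quad \widehat{\bm{O}}_i=\overline{\bm{A}}^\dagger\,\overline{\bm{B}}_i,\quad \widehat{\Psi}_i=\bm{b}_i-\widehat{\bm{O}}_i^\top\bm{a},\quad \widehat{\bm{X}}_i=\left(\bm{Y}_i-\mathbf{1}_{n_i}\widehat{\Psi}_i^\top\right)\widehat{\bm{O}}_i^\top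 ,$$ outputs $\widehat{\bm{X}}_i=\bm{X}_i$ for every non-colluding participant $i\in\mathcal{P}\setminus\{c\}$.
   Context: $\mathcal{O}(d)$ is the group of real orthogonal $d\times d$ matrices, $\mathbf{1}_m\in\mathbb{R}^m$ is the all-ones column vector, and $\bm{M}^\dagger$ is the Moore--Penrose pseudoinverse. Setting: $p$ participants hold private data $\bm{X}_i$ and share an anchor matrix $\bm{A}$; participant $i$ uploads $(\bm{Y}_i,\bm{B}_i)$ to an analyst (the AA-I-GDP protocol). In the analyst-participant collusion setting, one participant $c$ reveals its private data, its own secret parameters, and the shared matrix $\bm{A}$ to the analyst; the attacker does not directly know $\bm{X}_i,\bm{O}_i,\Psi_i$ for $i\ne c$. *)

(* Defs.v *)
(* MathComp; the real numbers are an arbitrary R : realType of MathComp-Analysis. *)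
From HB Require Import structures.
From mathcomp Require Import all_boot all_order all_algebra.
From mathcomp Require Import reals.

Set Implicit Arguments.
Unset Strict Implicit.
Unset Printing Implicit Defensive.

Import Order.TTheory GRing.Theory Num.Theory.
Local Open Scope ring_scope.

(* The four Penrose conditions characterizing P as the Moore-Penrose
   pseudoinverse of M; mathcomp's pinvmx is only some generalized inverse. *)
Definition penrose (R : realFieldType) (m n : nat)
    (M : 'M[R]_(m, n)) : pred 'M[R]_(n, m) :=
  fun P => [&& M *m P *m M == M,
               P *m M *m P == P,
               (M *m P)^T == M *m P
             & (P *m M)^T == P *m M].

Lemma mulmx_tr_eq0 (R : realFieldType) (m n : nat) (M : 'M[R]_(m, n)) :
  M *m M^T = 0 -> M = 0.
Proof.
move=> MM0; apply/matrixP => i j; rewrite mxE.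
have := congr1 (fun N : 'M_m => N i i) MM0; rewrite !mxE => /eqP.
rewrite psumr_eq0 => [/allP/(_ j (mem_index_enum j))|k _].
  by rewrite mxE /= mulf_eq0 orbb => /eqP.
by rewrite mxE -expr2 sqr_ge0.
Qed.

Lemma row_free_gram (R : realFieldType) (m n : nat) (M : 'M[R]_(m, n)) :
  row_free M -> M *m M^T \in unitmx.
Proof.
move=> freeM; rewrite -row_free_unit -kermx_eq0; apply/rowV0P => u /sub_kermxP.
move=> uMM0; apply/eqP; rewrite -(mulmx_free_eq0 _ freeM); apply/eqP.
by apply: mulmx_tr_eq0; rewrite trmx_mul !mulmxA -[u *m _ *m _]mulmxA uMM0 mul0mx.
Qed.

Lemma penrose_exists (R : realFieldType) (m n : nat) (M : 'M[R]_(m, n)) :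
  exists P : 'M[R]_(n, m), penrose M P.
Proof.
have [k [C [F [-> freeF freeC]]]] : exists k (C : 'M[R]_(m, k)) (F : 'M[R]_(k, n)),
    [/\ M = C *m F, row_free F & row_free C^T].
  exists (\rank M), (col_base M), (row_base M); rewrite mulmx_base row_base_free.
  by rewrite /row_free mxrank_tr -/(row_full _) col_base_full.
have uF : F *m F^T \in unitmx by exact: row_free_gram.
have uC : C^T *m C \in unitmx by rewrite -{2}[C]trmxK; exact: row_free_gram.
have symI (G : 'M[R]_k) : G^T = G -> (invmx G)^T = invmx G.
  by move=> GE; rewrite trmx_inv GE.
have sF : (invmx (F *m F^T))^T = invmx (F *m F^T).
  by apply: symI; rewrite trmx_mul trmxK.
have sC : (invmx (C^T *m C))^T = invmx (C^T *m C).
  by apply: symI; rewrite trmx_mul trmxK.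
pose P := F^T *m invmx (F *m F^T) *m (invmx (C^T *m C) *m C^T).
have MP : C *m F *m P = C *m invmx (C^T *m C) *m C^T.
  by rewrite /P -!mulmxA; congr (C *m _); rewrite !mulmxA mulmxV ?mul1mx.
have PM : P *m (C *m F) = F^T *m invmx (F *m F^T) *m F.
  rewrite /P -!mulmxA; congr (_ *m (_ *m _)).
  by rewrite (mulmxA C^T) mulKmx.
exists P; apply/and4P; split; apply/eqP.
- by rewrite MP -!mulmxA (mulmxA C^T) mulKmx.
- by rewrite PM /P -!mulmxA (mulmxA F F^T) mulKVmx.
- by rewrite MP !trmx_mul trmxK sC mulmxA.
- by rewrite PM !trmx_mul trmxK sF mulmxA.
Qed.

Lemma penrose_unique (R : realFieldType) (m n : nat) (M : 'M[R]_(m, n))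
    (P Q : 'M[R]_(n, m)) :
  penrose M P -> penrose M Q -> P = Q.
Proof.
case/and4P=> /eqP P1 /eqP P2 /eqP P3 /eqP P4.
case/and4P=> /eqP Q1 /eqP Q2 /eqP Q3 /eqP Q4.
have MPQ : M *m P = M *m Q.
  by rewrite -P3 -[in LHS]Q1 -mulmxA trmx_mul P3 Q3 mulmxA P1.
have PMQ : P *m M = Q *m M.
  rewrite -P4 -[in LHS]Q1 -[M *m Q *m M]mulmxA mulmxA trmx_mul P4 Q4.
  by rewrite mulmxA -[Q *m M *m P *m M]mulmxA -mulmxA (mulmxA M) P1.
by rewrite -P2 PMQ -mulmxA MPQ mulmxA Q2.
Qed.

Definition mppinv (R : realFieldType) (m n : nat) (M : 'M[R]_(m, n)) :
    'M[R]_(n, m) :=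
  xchoose (penrose_exists M).

Lemma mppinvP (R : realFieldType) (m n : nat) (M : 'M[R]_(m, n)) :
  penrose M (mppinv M).
Proof. exact: xchooseP. Qed.

Definition orthogonalmx (R : realFieldType) (d : nat) : qualifier 0 'M[R]_d :=
  [qualify Q : 'M[R]_d | (Q^T *m Q == 1%:M) && (Q *m Q^T == 1%:M)].

Definition ones (R : realFieldType) (m : nat) : 'cV[R]_m := const_mx 1.

Definition col_mean (R : realFieldType) (r d : nat) (M : 'M[R]_(r, d)) : 'cV[R]_d :=
  r%:R^-1 *: (M^T *m ones R r).

Definition centered (R : realFieldType) (r d : nat) (M : 'M[R]_(r, d)) :
    'M[R]_(r, d) :=
  M - ones R r *m (col_mean M)^T.

Section KnownAnchorAttack.
Variables (R : realFieldType) (d r p : nat) (n : 'I_p -> nat).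
(* Everything the attack uses: the anchor A and the uploads (Y_i, B_i). *)
Variables (A : 'M[R]_(r, d)) (YB : forall i : 'I_p, 'M[R]_(n i, d) * 'M[R]_(r, d)).

Definition attack_O (i : 'I_p) : 'M[R]_d :=
  mppinv (centered A) *m centered (YB i).2.

Definition attack_Psi (i : 'I_p) : 'cV[R]_d :=
  col_mean (YB i).2 - (attack_O i)^T *m col_mean A.

Definition known_anchor_attack (i : 'I_p) : 'M[R]_(n i, d) :=
  ((YB i).1 - ones R (n i) *m (attack_Psi i)^T) *m (attack_O i)^T.

End KnownAnchorAttack.

(* Main.v *)
(* Centering the anchor removes the translation: the centered B_i is the centered
   A times O_i, and full column rank makes the pseudoinverse a left inverse, so
   the attack recovers O_i exactly. Comparing means then gives Psi_i, and
   inverting the isometry gives X_i. *)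
Require Import Defs.
From HB Require Import structures.
From mathcomp Require Import all_boot all_order all_algebra.
From mathcomp Require Import reals.

Set Implicit Arguments.
Unset Strict Implicit.
Unset Printing Implicit Defensive.

Import Order.TTheory GRing.Theory Num.Theory.
Local Open Scope ring_scope.

(** The Gram product of [ones R r] with itself is the scalar [r], which the factor [r%:R^-1] cancels
    since [r] is positive. *)
Lemma col_mean_affine (R : realFieldType) (r d : nat) (A : 'M[R]_(r, d))
    (O : 'M[R]_d) (Psi : 'cV[R]_d) :
  (0 < r)%N ->
  col_mean (A *m O + ones R r *m Psi^T) = O^T *m col_mean A + Psi.
Proof.
move=> r_gt0; have r_neq0 : r%:R != 0 :> R by rewrite pnatr_eq0 -lt0n.
have ones_gram : (ones R r)^T *m ones R r = (r%:R)%:M.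
  apply/matrixP => i j; rewrite !ord1 !mxE.
  under eq_bigr do rewrite !mxE mulr1.
  by rewrite sumr_const card_ord.
rewrite /col_mean raddfD /= !trmx_mul trmxK mulmxDl scalerDr -!mulmxA ones_gram.
by rewrite mul_mx_scalar scalerA mulVf // scale1r scalemxAr.
Qed.

(** The mean picks up exactly [Psi], so the two copies of [ones R r *m Psi^T] cancel. *)
Lemma centered_affine (R : realFieldType) (r d : nat) (A : 'M[R]_(r, d))
    (O : 'M[R]_d) (Psi : 'cV[R]_d) :
  (0 < r)%N ->
  centered (A *m O + ones R r *m Psi^T) = centered A *m O.
Proof.
move=> r_gt0; rewrite /centered col_mean_affine // raddfD /= trmx_mul trmxK.
by rewrite mulmxDr mulmxBl !mulmxA opprD addrACA subrr addr0.
Qed.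

(** With [P = mppinv M], the first Penrose condition reads [M *m (P *m M) = M *m 1%:M]; full column
    rank cancels [M] on the left. *)
Lemma mul_mppinv_full (R : realFieldType) (m n : nat) (M : 'M[R]_(m, n)) :
  row_full M -> mppinv M *m M = 1%:M.
Proof.
move=> fullM; have /and4P[/eqP MPM _ _ _] := mppinvP M.
by apply: (row_full_inj fullM); rewrite mulmxA MPM mulmx1.
Qed.

Theorem proposition3p1 (R : realType) (d r p : nat)
    (d_ge1 : (1 <= d)%N) (r_ge1 : (1 <= r)%N) (p_ge1 : (1 <= p)%N)
    (n : 'I_p -> nat)
    (A : 'M[R]_(r, d))
    (X : forall i : 'I_p, 'M[R]_(n i, d))
    (O : 'I_p -> 'M[R]_d)
    (Psi : 'I_p -> 'cV[R]_d)
    (Y : forall i : 'I_p, 'M[R]_(n i, d))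
    (B : 'I_p -> 'M[R]_(r, d))
    (O_orth : forall i : 'I_p, O i \is orthogonalmx R d)
    (Y_def : forall i : 'I_p, Y i = X i *m O i + ones R (n i) *m (Psi i)^T)
    (B_def : forall i : 'I_p, B i = A *m O i + ones R r *m (Psi i)^T)
    (A_full_col_rank : \rank (centered A) = d)
    (c : 'I_p) :
  forall i : 'I_p, i != c ->
    known_anchor_attack A (fun j : 'I_p => (Y j, B j)) i = X i.
Proof.
move=> i _; rewrite /known_anchor_attack /attack_Psi.
have -> : attack_O A (fun j => (Y j, B j)) i = O i.
  rewrite /attack_O /= B_def centered_affine // mulmxA mul_mppinv_full ?mul1mx //.
  by rewrite /row_full A_full_col_rank.
(* The estimated translation collapses to [Psi i]; subtracting it from [Y i] leaves [X i *m O i], to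
   be multiplied by [(O i)^T]. *)
rewrite /= B_def col_mean_affine // [_ + Psi i]addrC addrK Y_def addrK -mulmxA.
by have /andP[_ /eqP ->] := O_orth i; rewrite mulmx1.
Qed.
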